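(* Let $h$ be an extremal positive $\mu_0$-harmonic function on the Heisenberg group $G=H_3(\mathbb{Z})$. Then, up to multiplication by a positive scalar, at least one of the following holds: \begin{itemize} \item $h=\chi$ is a $\mu_0$-harmonic character, i.e. $\chi(x,y,z)=r^x s^y$ for some real numbers $r,s>0$ with $\frac1r+\frac1s=1$; \item $h=h_0\circ\rho_{g_0}$ for some $g_0\in G$, where $h_0(x,y,z):=p_y(z)$; \item $h=h_1\circ\rho_{g_0}$ for some $g_0\in G$, where $h_1(x,y,z):=p_x(xy-z)$. \end{itemize}
   Context: The Heisenberg group $G=H_3(\mathbb{Z})$ is the set $\mathbb{Z}^3$ with the product $(x_0,y_0,z_0)(x,y,z)=(x_0+x,\,y_0+y,\,z_0+z+x_0y)$. Put $a=(1,0,0)$, $b=(0,1,0)$ and $\mu_0=\delta_{a^{-1}}+\delta_{b^{-1}}$. For a function $f:G\to\mathbb{R}$ set $P_{\mu_0}f(g)=f(a^{-1}g)+f(b^{-1}g)$, i.e. $P_{\mu_0}f(x,y,z)=f(x-1,y,z-y)+f(x,y-1,z)$. A function $h:G\to\mathbb{R}$ is $\mu_0$-harmonic if $h=P_{\mu_0}h$. A function $f$ on $G$ is called positive if $f(g)\ge 0$ for all $g\in G$ and $f\neq 0$. A positive $\mu_0$-harmonic function is extremal if it cannot be written as the sum of two non-proportional positive $\mu_0$-harmonic functions. For $g_0\in G$, $\rho_{g_0}:G\to G$ is the right translation $g\mapsto gg_0$. For integers $x,y,z\ge 0$, $p(x,y,z)$ is the number of $(n_1,\dots,n_y)\in\mathbb{Z}^y$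 with $x\ge n_1\ge\cdots\ge n_y\ge 0$ and $n_1+\cdots+n_y=z$ (so for $x\ge0$, $p(x,0,0)=1$ and $p(x,0,z)=0$ for $z\ne0$); $p(x,y,z)=0$ for all other $(x,y,z)\in\mathbb{Z}^3$. For $(y,z)\in\mathbb{Z}^2$, $p_y(z):=\sup_{x\in\mathbb{Z}}p(x,y,z)=\lim_{x\to\infty}p(x,y,z)$, which is the number of partitions of $z$ with at most $y$ rows (and is $0$ if $y<0$ or $z<0$). *)

(* Defs.v *)
From HB Require Import structures.
From mathcomp Require Import all_boot all_order all_algebra ring.
From mathcomp Require Import all_classical all_reals.
Set Implicit Arguments. Unset Strict Implicit. Unset Printing Implicit Defensive.
Import Order.TTheory GRing.Theory Num.Theory.
Local Open Scope ring_scope.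

Record heis := Heis { hx : int; hy : int; hz : int }.

Definition heis_tuple (g : heis) : int * int * int := (hx g, hy g, hz g).
Definition tuple_heis (t : int * int * int) : heis := Heis t.1.1 t.1.2 t.2.
Lemma heis_tupleK : cancel heis_tuple tuple_heis. Proof. by case. Qed.
HB.instance Definition _ := Choice.copy heis (can_type heis_tupleK).

Definition heis_one : heis := Heis 0 0 0.
Definition heis_mul (g k : heis) : heis :=
  Heis (hx g + hx k) (hy g + hy k) (hz g + hz k + hx g * hy k).
Definition heis_inv (g : heis) : heis :=
  Heis (- hx g) (- hy g) (- hz g + hx g * hy g).

Lemma heis_mulA : associative heis_mul.
Proof. by case=> a b c [d e f] [i j k]; congr Heis => /=; ring. Qed.
Lemma heis_mul1 : left_id heis_one heis_mul.
Proof. by case=> a b c; congr Heis => /=; ring. Qed.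
Lemma heis_mulr1 : right_id heis_one heis_mul.
Proof. by case=> a b c; congr Heis => /=; ring. Qed.
Lemma heis_mulV : left_inverse heis_one heis_inv heis_mul.
Proof. by case=> a b c; congr Heis => /=; ring. Qed.
Lemma heis_mulrV : right_inverse heis_one heis_inv heis_mul.
Proof. by case=> a b c; congr Heis => /=; ring. Qed.

HB.instance Definition _ := isGroup.Build heis
  heis_mulA heis_mul1 heis_mulr1 heis_mulV heis_mulrV.

Definition ha : heis := Heis 1 0 0.
Definition hb : heis := Heis 0 1 0.

Definition rho (g0 g : heis) : heis := (g * g0)%g.

Section Harmonic.
Variable R : realType.
Implicit Types f h chi : heis -> R.

Definition Pmu0 f (g : heis) : R := f (ha^-1 * g)%g + f (hb^-1 * g)%g.

Lemma Pmu0E f (x y z : int) :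
  Pmu0 f (Heis x y z) = f (Heis (x - 1) y (z - y)) + f (Heis x (y - 1) z).
Proof. by congr (f _ + f _); congr Heis => /=; ring. Qed.

Definition harmonic h : Prop := h = Pmu0 h.

Definition positive f : Prop := (forall g, 0 <= f g) /\ f <> (fun=> 0).

(* For nonzero [f1], [f2], the only case in which it is used, this relation
   is symmetric. *)
Definition proportional f1 f2 : Prop :=
  exists c : R, f1 = (fun g => c * f2 g).

Definition extremal h : Prop :=
  [/\ positive h, harmonic h &
   ~ exists h1 h2,
       [/\ positive h1 /\ harmonic h1, positive h2 /\ harmonic h2,
           ~ proportional h1 h2 & h = (fun g => h1 g + h2 g)]].

Definition harmonic_character chi : Prop :=
  exists r s : R, [/\ 0 < r, 0 < s, r^-1 + s^-1 = 1 &
    chi = (fun g => r ^ hx g * s ^ hy g)].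

Lemma harmonic_character_harmonic chi : harmonic_character chi -> harmonic chi.
Proof.
move=> [r [s [r0 s0 rs1 ->]]]; apply/funext => -[x y z]; rewrite Pmu0E /=.
rewrite !expfzDr ?gt_eqF// !exprN1.
by rewrite mulrAC [X in _ + X]mulrA -mulrDr rs1 mulr1.
Qed.

Lemma harmonic_characterM chi : harmonic_character chi ->
  forall g k, chi (g * k)%g = chi g * chi k.
Proof.
move=> [r [s [r0 s0 _ ->]]] g k /=.
by rewrite !expfzDr ?gt_eqF// mulrACA.
Qed.

End Harmonic.

(* The constraint x >= n_1 >= ... >= n_y >= 0 confines every n_i to
   {0, ..., x}, so the integer sequences counted are the nonincreasing
   y-tuples over 'I_x.+1. *)
Definition p (x y z : int) : nat :=
  match x, y with
  | Posz m, Posz n =>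
      #|[set t : n.-tuple 'I_m.+1 |
          sorted (fun i j : 'I_m.+1 => (j <= i)%N) t
          && ((\sum_(i <- t) i)%N%:Z == z)]|
  | _, _ => 0%N
  end.

Section Limit.
Variable R : realType.

Definition p_sup (y z : int) : R :=
  sup (range (fun x : int => (p x y z)%:R : R)).

(* [sup] is not at its default value here. *)
Lemma p_has_sup (y z : int) : has_sup (range (fun x : int => (p x y z)%:R : R)).
Proof.
split; first by exists (p 0 y z)%:R, 0.
case: y => [n|n]; last by exists 0 => _ [[m|m] _ <-].
exists (#|{: n.-tuple 'I_(`|z|%N).+1}|)%:R => _ [[m|m] _ <-] /=; last exact: ler0n.
rewrite ler_nat -cardsT.
set A := [set t | _].
pose F (t : n.-tuple 'I_m.+1) := map_tuple (fun i : 'I_m.+1 => inord i : 'I_(`|z|%N).+1) t.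
have bnd t i : t \in A -> i \in val t -> (i < (`|z|%N).+1)%N.
  rewrite inE => /andP[_ /eqP <-] it.
  by rewrite ltnS absz_nat (big_rem _ it) leq_addr.
have Finj : {in A &, injective F}.
  move=> t u tA uA /(congr1 val) /= /(congr1 (map val)); rewrite -!map_comp => e.
  have FK v : v \in A -> map (val \o (fun i : 'I_m.+1 => inord i : 'I_(`|z|%N).+1)) v
                         = map val v.
    by move=> vA; apply/eq_in_map => i iv; rewrite /= inordK// (bnd v).
  by apply/val_inj/(inj_map val_inj); rewrite -!FK.
by rewrite -(card_in_imset Finj) subset_leq_card// subsetT.
Qed.

Definition h0 (g : heis) : R := p_sup (hy g) (hz g).
Definition h1 (g : heis) : R := p_sup (hx g) (hx g * hy g - hz g).

End Limit.

(* Main.v *)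
(** Write a, b, c for the generators and the central element (0, 0, 1), so that
    h g = h (a^-1 g) + h (b^-1 g).  If h (a^-n g0) stays above some l > 0, then
    counting the paths from g to a^-n g0 gives h >= l p_y(z) along a right
    translate, and extremality makes this a proportionality; the same for b, by
    the automorphism [sigma] exchanging a and b.  Otherwise a path of the
    h-process uses both letters infinitely often.  Postponing a first step
    a^-1 until k letters b^-1 have been read multiplies the end point by a power
    of c, whence h (a^-1 g) <= h (g c^-k) and h (b^-1 g) <= h (g c^k) for all
    k >= 0.  For k = 1 these say that h is not disjoint from both of its
    translates by c and c^-1, hence h (g c) = t h g for a scalar t, and letting
    k tend to infinity forces t = 1.  Thus h lives on the abelianization Z^2,
    where the right translates of h by a^-1 and b^-1 are dominated by h and hence
    proportional to it. *)
Require Import Defs.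
From mathcomp Require Import all_boot all_order all_algebra ring lra zify.
From mathcomp Require Import all_classical all_reals.
Set Implicit Arguments. Unset Strict Implicit. Unset Printing Implicit Defensive.
Import Order.TTheory GRing.Theory Num.Theory.
Local Open Scope ring_scope.

(** * Suprema of sums and of cofinal families *)

Section Suprema.
Variable R : realType.

(** Directedness bounds each mixed sum [F i + G j] by a diagonal one [F k + G k]. *)
Lemma sup_add_directed (I : Type) (F G : I -> R) :
  has_sup (range F) -> has_sup (range G) ->
  (forall i j, exists k, F i <= F k /\ G j <= G k) ->
  sup (range (fun i => F i + G i)) = sup (range F) + sup (range G).
Proof.
move=> hF hG dir; have [[_ [i0 _ _]] _] := hF.
have ub : ubound (range (fun i => F i + G i)) (sup (range F) + sup (range G)).
  by move=> _ [i _ <-]; apply: lerD; apply: ub_le_sup;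
    [exact: hF.2 | exists i | exact: hG.2 | exists i].
have hFG : has_ubound (range (fun i => F i + G i)).
  by exists (sup (range F) + sup (range G)).
apply/eqP; rewrite eq_le; apply/andP; split.
  by apply: ge_sup ub; exists (F i0 + G i0), i0.
rewrite -lerBrDr; apply: ge_sup => [|_ [i _ <-]]; first by exists (F i0), i0.
rewrite lerBrDl -lerBrDr; apply: ge_sup => [|_ [j _ <-]]; first by exists (G i0), i0.
have [k [Fik Gjk]] := dir i j.
rewrite lerBrDl; apply: (le_trans (lerD Fik Gjk)).
by apply: ub_le_sup => //; exists k.
Qed.

(** The element of [J] makes both ranges nonempty, so that [sup] is not at its default value. *)
Lemma sup_range_cofinal (I J : Type) (F : I -> R) (G : J -> R) :
  J -> has_ubound (range F) ->
  (forall i, exists j, F i <= G j) -> (forall j, exists i, G j <= F i) ->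
  sup (range F) = sup (range G).
Proof.
move=> j0 hF FG GF; have [i0 _] := GF j0; have [M FM] := hF.
have hG : has_ubound (range G).
  by exists M => _ [j _ <-]; have [i Gi] := GF j; apply: (le_trans Gi); apply: FM; exists i.
apply/eqP; rewrite eq_le; apply/andP; split.
  apply: ge_sup => [|_ [i _ <-]]; first by exists (F i0), i0.
  by have [j Fj] := FG i; apply: (le_trans Fj); apply: ub_le_sup => //; exists j.
apply: ge_sup => [|_ [j _ <-]]; first by exists (G j0), j0.
by have [i Gi] := GF j; apply: (le_trans Gi); apply: ub_le_sup => //; exists i.
Qed.

End Suprema.

(** * Harmonic functions, extremality and harmonic majorants *)

Section Operator.
Variable R : realType.
Implicit Types f h k : heis -> R.

Lemma Pmu0_le f1 f2 : (forall g, f1 g <= f2 g) -> forall g, Pmu0 f1 g <= Pmu0 f2 g.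
Proof. by move=> le g; apply: lerD. Qed.

Lemma Pmu0_rho f (k : heis) : Pmu0 (f \o rho k) = Pmu0 f \o rho k.
Proof. by apply/funext => g; rewrite /Pmu0 /= /rho !mulgA. Qed.

Lemma harmonic_rho h (k : heis) : harmonic h -> harmonic (h \o rho k).
Proof. by move=> hh; rewrite /harmonic Pmu0_rho -hh. Qed.

Lemma positive_rho h (k : heis) : positive h -> positive (h \o rho k).
Proof.
move=> [h0 hn]; split=> [g|e]; first exact: h0.
apply: hn; apply/funext => g; have /= := congr1 (@^~ (g * k^-1)%g) e.
by rewrite /rho -mulgA mulVg mulg1.
Qed.

Lemma harmonicZ h c : harmonic h -> harmonic (fun g => c * h g).
Proof. by move=> hh; apply/funext => g; rewrite {1}hh /Pmu0 mulrDr. Qed.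

Lemma harmonicB h1 h2 : harmonic h1 -> harmonic h2 -> harmonic (fun g => h1 g - h2 g).
Proof. by move=> e1 e2; apply/funext => g; rewrite {1}e1 {1}e2 /Pmu0 opprD addrACA. Qed.

Lemma positive_gt0 f : positive f -> exists g, 0 < f g.
Proof.
move=> [f0 fn]; apply: contrapT => /forallNP nf; apply: fn; apply/funext => g.
by apply/eqP; rewrite eq_le f0 andbT leNgt; apply/negP/nf.
Qed.

(** Unless [h] is already [e * f], it splits into the positive harmonic functions [e * f] and
    [h - e * f], which extremality makes proportional. Every proportionality below is obtained in
    this way. *)
Lemma extremal_dominates h f (e : R) : extremal h -> positive f -> harmonic f ->
  0 < e -> (forall g, e * f g <= h g) -> exists2 c : R, 0 < c & h = (fun g => c * f g).
Proof.
move=> [hp hh next] fp fh e0 le.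
case: (pselect (h = fun g => e * f g)) => [->|nef]; first by exists e.
have [g0 fg0] := positive_gt0 fp.
have p1 : positive (fun g => e * f g).
  split=> [g|/(congr1 (@^~ g0))/eqP]; first exact: mulr_ge0 (ltW e0) (fp.1 g).
  by rewrite mulf_eq0 !gt_eqF.
have p2 : positive (fun g => h g - e * f g).
  split=> [g|eq0]; first by rewrite subr_ge0.
  by apply: nef; apply/funext => g; apply/eqP; rewrite -subr_eq0; apply/eqP/(congr1 (@^~ g) eq0).
have [] : proportional (fun g => e * f g) (fun g => h g - e * f g).
  apply: contrapT => np; apply: next; exists (fun g => e * f g), (fun g => h g - e * f g).
  split=> //; [|split=> //|].
  - by split=> //; apply: harmonicZ.
  - by apply: harmonicB => //; apply: harmonicZ.
  - by apply/funext => g; rewrite addrC subrK.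
move=> c ce; have cE g : e * f g = c * (h g - e * f g) := congr1 (@^~ g) ce.
have c0 : 0 < c.
  have: 0 < c * (h g0 - e * f g0) by rewrite -cE mulr_gt0.
  rewrite pmulr_lgt0 // lt_neqAle p2.1 andbT; apply/eqP => hz.
  by move/eqP: (cE g0); rewrite -hz mulr0 mulf_eq0 !gt_eqF.
(* Solving [e * f = c * (h - e * f)] for [h] gives this factor. *)
exists ((1 + c) / c * e); first by rewrite mulr_gt0 // divr_gt0 // addr_gt0.
apply/funext => g; apply: (mulfI (lt0r_neq0 c0)).
have := cE g; rewrite mulrBr => /eqP; rewrite eq_sym subr_eq => /eqP ->.
by field; exact: lt0r_neq0.
Qed.

(* The majorant is the increasing limit of the iterates of [k] under [Pmu0]. *)
Lemma least_harmonic_majorant k f0 :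
  (forall g, k g <= Pmu0 k g) -> (forall g, Pmu0 f0 g <= f0 g) ->
  (forall g, k g <= f0 g) ->
  exists K, [/\ harmonic K, forall g, k g <= K g &
    forall f, (forall g, Pmu0 f g <= f g) -> (forall g, k g <= f g) ->
      forall g, K g <= f g].
Proof.
move=> ksub f0super kf0; pose kn n := iter n (@Pmu0 R) k.
have kn_bound f : (forall g, Pmu0 f g <= f g) -> (forall g, k g <= f g) ->
    forall n g, kn n g <= f g.
  move=> fs kf; elim=> [//|n IH] g; exact: le_trans (Pmu0_le IH g) (fs g).
have knS n : forall g, kn n g <= kn n.+1 g.
  by elim: n => [//|n IH] g; apply: Pmu0_le.
have kn_mono g : {homo (fun n => kn n g) : m n / (m <= n)%N >-> m <= n}.
  by apply: homo_leq => [//|y x z|n]; [exact: le_trans|exact: knS].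
(* The superharmonic [f0] bounds all iterates, so the suprema below are genuine. *)
have ksup g : has_sup (range (fun n => kn n g)).
  split; first by exists (kn 0%N g), 0%N.
  by exists (f0 g) => _ [n _ <-]; apply: kn_bound.
exists (fun g => sup (range (fun n => kn n g))); split.
- apply/funext => g; rewrite /Pmu0 -sup_add_directed //; last first.
    by move=> i j; exists (maxn i j); split; apply: kn_mono; rewrite ?leq_maxl ?leq_maxr.
  (* Applying [Pmu0] shifts the increasing sequence of iterates by one, which leaves its supremum
     unchanged. *)
  apply: (sup_range_cofinal 0%N) => //; first exact: (ksup g).2.
  + by move=> n; exists n; exact: knS.
  + by move=> n; exists n.+1.
- by move=> g; apply: ub_le_sup; [exact: (ksup g).2|exists 0%N].
- move=> f fs kf g; apply: ge_sup; first exact: (ksup g).1.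
  by move=> _ [n _ <-]; apply: kn_bound.
Qed.

End Operator.

(** * Partitions in a box and the recursion for [p] *)

Definition box_partitions m n (z : int) : {set n.-tuple 'I_m.+1} :=
  [set t : n.-tuple 'I_m.+1 |
     sorted (fun i j : 'I_m.+1 => (j <= i)%N) t && ((\sum_(i <- t) i)%N%:Z == z)].

Lemma box_partitions0 m z : #|box_partitions m 0 z| = (z == 0).
Proof.
have -> : box_partitions m 0 z = if z == 0 then [set [tuple]] else finset.set0.
  apply/setP => t; rewrite tuple0 !inE big_nil /= eq_sym.
  by case: ifP; rewrite !inE ?eqxx.
by case: ifP; rewrite ?cards1 ?cards0.
Qed.

Lemma box_partitions_rcons m n z (t : n.-tuple 'I_m.+1) :
  (rcons_tuple t ord0 \in box_partitions m n.+1 z) = (t \in box_partitions m n z).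
Proof.
rewrite !inE big_rcons_op /= addn0; congr (_ && _).
case: t => -[|x s] /= _ //.
by rewrite rcons_path leq0n andbT.
Qed.

Lemma box_partitions_lift m n z (t : n.-tuple 'I_m.+1) :
  (map_tuple (lift ord0) t \in box_partitions m.+1 n z)
  = (t \in box_partitions m n (z - n%:Z)).
Proof.
rewrite !inE /= sorted_map big_map; congr (_ && _).
under eq_bigr do rewrite lift0 -addn1.
by rewrite big_split /= sum1_size size_tuple PoszD [RHS]eq_sym subr_eq eq_sym.
Qed.

(* A partition whose last part is 0 has one row less; otherwise removing its
   first column lowers every part by one. *)
Lemma box_partitions_last0 m n z :
  [set t in box_partitions m n.+1 z | last ord0 t == ord0]
  = [set rcons_tuple t ord0 | t in box_partitions m n z].
Proof.
apply/setP => t; apply/idP/imsetP => [|[u uB ->]]; last first.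
  by rewrite inE box_partitions_rcons uB last_rcons eqxx.
rewrite inE => /andP[tB /eqP t0].
move: tB t0; case/tupleP: t => x s tB t0.
pose u := [tuple of belast x s].
have tE : [tuple of x :: s] = rcons_tuple u ord0.
  by apply: val_inj; rewrite /= -t0 -lastI.
by exists u => //; rewrite -box_partitions_rcons -tE.
Qed.

Lemma box_partitions_last_neq0 m n z :
  [set t in box_partitions m.+1 n.+1 z | last ord0 t != ord0]
  = [set map_tuple (lift ord0) t | t in box_partitions m n.+1 (z - n.+1%:Z)].
Proof.
apply/setP => t; apply/idP/imsetP => [|[u uB ->]]; last first.
  by rewrite inE box_partitions_lift uB; case/tupleP: u {uB} => x s; rewrite /= last_map.
rewrite inE => /andP[tB t0].
(* The last part is the smallest, so all parts are positive and taking predecessors loses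
   nothing. *)
have t_gt0 i : i \in val t -> (0 < i)%N.
  move: tB; rewrite inE => /andP[ts _] it.
  move: t0 ts it; case/tupleP: t => x s /=; rewrite -/(sorted _ (x :: s)) lastI.
  move: (last x s) (belast x s) => y s'; rewrite -[y != ord0]lt0n => y_gt0.
  rewrite sorted_pairwise; last by move=> a b c ab bc; apply: leq_trans bc ab.
  rewrite pairwise_rcons => /andP[/allP sy _]; rewrite mem_rcons inE => /predU1P[->//|/sy yi].
  exact: leq_trans yi.
pose u := map_tuple (fun i : 'I_m.+2 => inord i.-1 : 'I_m.+1) t.
have tE : t = map_tuple (lift ord0) u.
  apply: val_inj; rewrite /= -map_comp -[LHS]map_id; apply/eq_in_map => i /t_gt0 i0.
  have im : (i.-1 < m.+1)%N by rewrite -ltnS prednK.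
  by apply: val_inj; rewrite /= inordK // /bump leq0n add1n prednK.
by exists u => //; rewrite -box_partitions_lift -tE.
Qed.

(** Partitions are split by whether the last part is 0. In a box of width 0 every part is 0, whence
    the term [0%N]. *)
Lemma card_box_partitions m n z :
  #|box_partitions m n.+1 z|
  = (if m is m'.+1 then #|box_partitions m' n.+1 (z - n.+1%:Z)| else 0%N)
    + #|box_partitions m n z| :> nat.
Proof.
have card_last0 : #|[set t in box_partitions m n.+1 z | last ord0 t == ord0]|
    = #|box_partitions m n z|.
  rewrite box_partitions_last0 card_imset // => t u /(congr1 val) /= /rcons_inj[tu].
  exact: val_inj.
rewrite -card_last0 -(cardsID [set t : n.+1.-tuple 'I_m.+1 | last ord0 t == ord0]) addnC.
rewrite -!setIdE; congr (_ + _)%N.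
case: m {card_last0} => [|m].
  by apply/eqP; rewrite cards_eq0; apply/eqP/setP => t; rewrite !inE (ord1 (last _ _)).
transitivity #|[set t in box_partitions m.+1 n.+1 z | last ord0 t != ord0]|.
  by apply: eq_card => t; rewrite !inE andbC.
rewrite box_partitions_last_neq0 card_imset // => t u /(congr1 val) /= tu.
by apply/val_inj; apply: inj_map tu; apply: lift_inj.
Qed.

Lemma p_box m n z : p m%:Z n%:Z z = #|box_partitions m n z|.
Proof. by []. Qed.

Lemma p_lt0l (x y z : int) : x < 0 -> p x y z = 0%N.
Proof. by case: x. Qed.

Lemma p_lt0r (x y z : int) : y < 0 -> p x y z = 0%N.
Proof. by case: x y => [m|m] [n|n]. Qed.

(** This is the harmonicity of [p] away from the center. It fails at the identity, where [p] is 1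
    and both terms on the right vanish. *)
Lemma p_rec (x y z : int) : (x, y) != (0, 0) ->
  p x y z = (p (x - 1) y (z - y) + p x (y - 1) z)%N.
Proof.
have predz k : k.+1%:Z - 1 = k%:Z by lia.
case: x y => [m|m] y xy0; last by rewrite !p_lt0l.
case: y xy0 => [n|n] xy0; last by rewrite !p_lt0r.
case: n xy0 => [|n] xy0; last first.
  rewrite predz !p_box card_box_partitions; case: m {xy0} => [|m].
    by rewrite p_lt0l.
  by rewrite predz.
case: m xy0 => [//|m] _.
by rewrite (@p_lt0r _ (0 - 1)) // subr0 addn0 predz !p_box !box_partitions0.
Qed.

Lemma p00 (z : int) : p 0 0 z = (z == 0).
Proof. exact: box_partitions0. Qed.

(** Induction on [x + y], comparing the recursions of both sides term by term. *)
Lemma p_leS (x y z : int) : (p x y z <= p (x + 1) y z)%N.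
Proof.
have predz k : k.+1%:Z - 1 = k%:Z by lia.
case: x y => [m|m] [n|n] //.
have [k kE] : exists k, (m + n)%N = k by exists (m + n)%N.
elim: k m n z kE => [|k IH] m n z kE.
  have [-> ->] : m = 0%N /\ n = 0%N by lia.
  by rewrite (p_rec (x := 0 + 1)) // addrK subr0 leq_addr.
rewrite (p_rec (x := m%:Z)); last by apply/eqP; case; lia.
rewrite (p_rec (x := m%:Z + 1)); last by apply/eqP; case; lia.
apply: leq_add; rewrite ?addrK.
  case: m kE => [//|m] kE.
  by rewrite predz (_ : m.+1%:Z = m%:Z + 1); [apply: IH|]; lia.
case: n kE => [//|n] kE.
by rewrite predz; apply: IH; lia.
Qed.

Lemma p_le (x1 x2 y z : int) : x1 <= x2 -> (p x1 y z <= p x2 y z)%N.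
Proof.
move=> le12; have [k ->] : exists k : nat, x2 = x1 + k%:Z by exists `|x2 - x1|%N; lia.
elim: k => [|k IH]; first by rewrite addr0.
by rewrite -[k.+1]addn1 PoszD addrA; apply: leq_trans IH _; apply: p_leS.
Qed.

(** * The harmonic function [h0] and path counting *)

Section PartitionFunctions.
Variable R : realType.

Lemma p_le_p_sup (x y z : int) : (p x y z)%:R <= p_sup R y z.
Proof. by apply: ub_le_sup; [exact: (p_has_sup R y z).2 | exists x]. Qed.

(** The recursion for [p] passes to the limit in [x], where the shift [x - 1] disappears. *)
Lemma p_sup_rec (y z : int) : p_sup R y z = p_sup R y (z - y) + p_sup R (y - 1) z.
Proof.
rewrite /p_sup -sup_add_directed; [|exact: p_has_sup..|]; last first.
  move=> i j; exists (Num.max i j).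
  by rewrite !ler_nat !p_le // le_max lexx ?orbT.
(* The index [|i| + 1] avoids the exceptional point of [p_rec], and both it and its predecessor are
   at least [i]. *)
have pos (i : int) : (`|i| + 1, y) != (0, 0) by apply/eqP; case; lia.
apply: (sup_range_cofinal (0 : int)) => [|i|j]; first exact: (p_has_sup R y z).2.
- exists (`|i| + 1); rewrite -natrD ler_nat.
  have /p_le /leq_trans : i <= `|i| + 1 by lia.
  apply; rewrite (p_rec _ (pos i)) leq_add2r p_le //; lia.
- exists (`|j| + 1); rewrite -natrD ler_nat (p_rec _ (pos j)).
  by apply: leq_add; apply: p_le; lia.
Qed.

Lemma h0_harmonic : harmonic (h0 R).
Proof. by apply/funext => -[x y z]; rewrite Pmu0E; exact: p_sup_rec. Qed.

Lemma h0_positive : positive (h0 R).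
Proof.
split=> [g|/(congr1 (@^~ (Heis 0 0 0)))/= e].
  by apply: le_trans (p_le_p_sup 0 _ _); rewrite ler0n.
have := p_le_p_sup 0 0 0; rewrite p00 eqxx.
by have -> : p_sup R 0 0 = 0 by []; rewrite ler10.
Qed.

(** [p x y z] counts the paths from [(x, y, z)] to the identity with steps [ha^-1] and [hb^-1].
    Expanding [f] by harmonicity yields [f 1] once for each of them, and the other terms are
    nonnegative. *)
Lemma p_mul_le (f : heis -> R) (x y z : int) : (forall g, 0 <= f g) -> harmonic f ->
  (p x y z)%:R * f 1%g <= f (Heis x y z).
Proof.
move=> f0 fh; have [x0|x0] := ltP x 0; first by rewrite p_lt0l // mul0r.
have [y0|y0] := ltP y 0; first by rewrite p_lt0r // mul0r.
have [k kE] : exists k, (`|x| + `|y|)%N = k by eexists.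
elim: k x y z x0 y0 kE => [|k IH] x y z x0 y0 kE.
  have [-> ->] : x = 0 /\ y = 0 by lia.
  by rewrite p00; case: eqP => [->|_]; rewrite ?mul1r ?mul0r.
have xy0 : (x, y) != (0, 0) by apply/eqP; case; lia.
rewrite [leRHS](congr1 (@^~ _) fh) Pmu0E p_rec // natrD mulrDl; apply: lerD.
- have [x1|x1] := ltP (x - 1) 0; first by rewrite p_lt0l // mul0r.
  by apply: IH => //; lia.
- have [y1|y1] := ltP (y - 1) 0; first by rewrite p_lt0r // mul0r.
  by apply: IH => //; lia.
Qed.

End PartitionFunctions.

(** * The central element and the automorphism exchanging the generators *)

Definition hc : heis := Heis 0 0 1.

Lemma haXE n : (ha ^+ n)%g = Heis n%:Z 0 0.
Proof.
by elim: n => [//|n IH]; rewrite expgSr IH; congr Heis; rewrite /=; lia.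
Qed.

Lemma commutator_ab g : (hb^-1 * (ha^-1 * g) = ha^-1 * (hb^-1 * (g * hc^-1)))%g.
Proof. by case: g => x y z; congr Heis => /=; ring. Qed.

(** This automorphism inverts the center, and [h0 \o sigma] is [h1] by conversion. *)
Definition sigma (g : heis) : heis := Heis (hy g) (hx g) (hx g * hy g - hz g).

Lemma sigmaK : involutive sigma.
Proof. by case=> x y z; congr Heis => /=; ring. Qed.

Lemma sigmaM g k : sigma (g * k)%g = (sigma g * sigma k)%g.
Proof. by case: g k => x y z [x' y' z']; congr Heis => /=; ring. Qed.

Lemma sigmaV g : sigma g^-1%g = ((sigma g)^-1)%g.
Proof. by case: g => x y z; congr Heis => /=; ring. Qed.

Lemma sigma_ha : sigma ha = hb. Proof. by []. Qed.
Lemma sigma_hb : sigma hb = ha. Proof. by []. Qed.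
Lemma sigma_hc : sigma hc = hc^-1%g. Proof. by []. Qed.

Lemma sigmaX g n : sigma (g ^+ n)%g = (sigma g ^+ n)%g.
Proof. by elim: n => [//|n IH]; rewrite !expgS sigmaM IH. Qed.

Section Sigma.
Variable R : realType.
Implicit Types f h : heis -> R.

Lemma harmonic_sigma h : harmonic h -> harmonic (h \o sigma).
Proof.
by move=> hh; apply/funext => g; rewrite /Pmu0 /= !sigmaM !sigmaV sigma_ha sigma_hb {1}hh addrC.
Qed.

Lemma positive_sigma h : positive h -> positive (h \o sigma).
Proof.
move=> [h0 hn]; split=> [g|e]; first exact: h0.
by apply: hn; apply/funext => g; rewrite -(sigmaK g); exact: (congr1 (@^~ (sigma g)) e).
Qed.

Lemma extremal_sigma h : extremal h -> extremal (h \o sigma).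
Proof.
move=> [hp hh next]; split; [exact: positive_sigma|exact: harmonic_sigma|].
move=> [f1 [f2 [[p1 e1] [p2 e2] np e]]]; apply: next.
exists (f1 \o sigma), (f2 \o sigma); split.
- by split; [exact: positive_sigma|exact: harmonic_sigma].
- by split; [exact: positive_sigma|exact: harmonic_sigma].
- move=> [c ce]; apply: np; exists c; apply/funext => g.
  by rewrite -(sigmaK g); exact: (congr1 (@^~ (sigma g)) ce).
- by apply/funext => g; rewrite -{1}(sigmaK g); exact: (congr1 (@^~ (sigma g)) e).
Qed.

End Sigma.

(** * Behavior of [h] along the powers of a generator *)

Section Shift.
Variable R : realType.
Implicit Types f h : heis -> R.

Lemma extremal_along_a h (g0 : heis) (l : R) : extremal h -> 0 < l ->
  (forall n, l <= h (ha ^- n * g0)%g) ->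
  exists2 c, 0 < c & h = (fun g => c * (h0 R \o rho g0^-1%g) g).
Proof.
move=> hext l0 hl; have [hp hh _] := hext.
apply: (extremal_dominates hext _ _ l0).
- exact/positive_rho/h0_positive.
- exact/harmonic_rho/h0_harmonic.
move=> g; rewrite mulrC -ler_pdivlMr //=; set k := rho _ g.
apply: ge_sup => [|_ [x _ <-]]; first by exists (p 0 (hy k) (hz k))%:R, 0.
(* Right multiplication of [k] by [ha ^+ n] raises only its first coordinate, so starting the count
   at [ha ^- n * g0] reaches any prescribed width [x]. *)
rewrite ler_pdivlMr //; have [n xn] : exists n : nat, x <= hx k + n%:Z.
  by move: (hx k) => y; exists `|x - y|%N; lia.
pose f := h \o rho (ha ^- n * g0)%g.
have gE : (Heis (hx k + n%:Z) (hy k) (hz k) * (ha ^- n * g0))%g = g.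
  have -> : Heis (hx k + n%:Z) (hy k) (hz k) = (k * ha ^+ n)%g.
    by rewrite haXE; case: (k) => a b c; congr Heis => /=; ring.
  by rewrite -!mulgA mulVKg mulVg mulg1.
have := @p_mul_le _ f (hx k + n%:Z) (hy k) (hz k) (fun g => hp.1 _) (harmonic_rho _ hh).
rewrite /f /= /rho gE mul1g; apply: le_trans.
apply: ler_pM (hl n); [exact: ler0n|exact: ltW|].
by rewrite ler_nat; apply: p_le.
Qed.

Lemma shift_along_a h : (forall g, 0 <= h g) -> harmonic h ->
  (forall g e, 0 < e -> exists n, h (ha ^- n * g)%g < e) ->
  forall k g, h (ha^-1 * g)%g <= h (g * hc ^- k)%g.
Proof.
move=> h_ge0 hh van; have ha_le g : h (ha^-1 * g)%g <= h g.
  by rewrite [leRHS](congr1 (@^~ g) hh) lerDl.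
elim=> [|k IH] g; first by rewrite expg0 invg1 mulg1.
(* [D] does not decrease along g, a^-1 g, a^-2 g, ..., where [h] tends to 0. *)
pose D g := h (ha^-1 * g)%g - h (g * hc ^- k.+1)%g.
have DS g' : D g' <= D (ha^-1 * g')%g.
  (* After both terms of [D] are expanded by harmonicity, the [ha^-1] terms form [D (ha^-1 * g')].
     The [hb^-1] terms are compared by the induction hypothesis, the commutator supplying one more
     factor [hc^-1]. *)
  have := IH (hb^-1 * (g' * hc^-1))%g; rewrite -commutator_ab -!mulgA -invgM -expgSr.
  rewrite /D [X in X - _](congr1 (@^~ _) hh) [X in _ - X <= _](congr1 (@^~ _) hh) /Pmu0.
  by rewrite -!mulgA; lra.
have Dn n g' : D g' <= D (ha ^- n * g')%g.
  elim: n g' => [|n IHn] g'; first by rewrite expg0 invg1 mul1g.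
  by apply: le_trans (DS g') _; rewrite expgS invgM -mulgA.
rewrite -subr_le0; apply/ler_addgt0Pr => e /(van g)[n hn]; rewrite add0r.
apply: (le_trans (Dn n g)); apply: le_trans (ltW hn).
by rewrite /D lerBlDr; apply: le_trans (ha_le _) _; rewrite lerDl.
Qed.

(** Transport by [sigma], whose inversion of [hc] changes the sign of the exponent. *)
Lemma shift_along_b h : (forall g, 0 <= h g) -> harmonic h ->
  (forall g e, 0 < e -> exists n, h (hb ^- n * g)%g < e) ->
  forall k g, h (hb^-1 * g)%g <= h (g * hc ^+ k)%g.
Proof.
move=> h_ge0 /harmonic_sigma hh van k g.
have := @shift_along_a (h \o sigma) _ hh _ k (sigma g).
rewrite /= !sigmaM !sigmaV sigmaX sigma_ha sigma_hc sigmaK expVgn invgK; apply=> // g' e e0.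
by have [n] := van (sigma g') e e0; exists n; rewrite /= sigmaM sigmaV sigmaX.
Qed.

End Shift.

(** * Invariance under the center and characters *)

Section Character.
Variable R : realType.
Implicit Types f h : heis -> R.

Lemma max0_subharmonic f : harmonic f ->
  forall g, Num.max 0 (f g) <= Pmu0 (fun g => Num.max 0 (f g)) g.
Proof.
move=> fh g; rewrite ge_max addr_ge0 ?le_max ?lexx //=.
by rewrite [leLHS](congr1 (@^~ g) fh) lerD // le_max lexx orbT.
Qed.

Lemma extremal_hc_eigen h : extremal h ->
  (forall g, h (ha^-1 * g)%g <= h (g * hc^-1)%g) ->
  (forall g, h (hb^-1 * g)%g <= h (g * hc)%g) ->
  exists2 c, 0 < c & forall g, h (g * hc)%g = c * h g.
Proof.
move=> hext ha_le hb_le; have [hp hh _] := hext.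
have hE g : h g = h (ha^-1 * g)%g + h (hb^-1 * g)%g := congr1 (@^~ g) hh.
(* If the least harmonic majorants of the positive parts of [h - h \o rho hc]
   and [h - h \o rho hc^-1] were both [h], their sum could not be below [h]. *)
pose kp g := Num.max 0 (h g - h (g * hc)%g).
pose km g := Num.max 0 (h g - h (g * hc^-1)%g).
have kp_sub : forall g, kp g <= Pmu0 kp g.
  exact/max0_subharmonic/harmonicB/harmonic_rho.
have km_sub : forall g, km g <= Pmu0 km g.
  exact/max0_subharmonic/harmonicB/harmonic_rho.
have kpm g : kp g + km g <= h g.
  have kp_le : kp g <= h (ha^-1 * g)%g.
    by rewrite ge_max hp.1 lerBlDr [leLHS]hE lerD2l hb_le.
  have km_le : km g <= h (hb^-1 * g)%g.
    by rewrite ge_max hp.1 lerBlDl [leLHS]hE lerD2r ha_le.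
  by rewrite hE lerD.
have h_super g : Pmu0 h g <= h g by rewrite -(congr1 (@^~ g) hh).
have kp0 g : 0 <= kp g by rewrite le_max lexx.
have km0 g : 0 <= km g by rewrite le_max lexx.
have [Kp [Kp_h kp_Kp Kp_min]] := least_harmonic_majorant kp_sub h_super
  (fun g => le_trans (ler_wpDr (km0 g) (lexx _)) (kpm g)).
have [Km [Km_h km_Km Km_min]] := least_harmonic_majorant km_sub h_super
  (fun g => le_trans (ler_wpDl (kp0 g) (lexx _)) (kpm g)).
(* Minimality is used twice: for [Kp] against the harmonic [h - Km], then for [Km] against [h - kp],
   which is in general only superharmonic. *)
have Kpm g : Kp g + Km g <= h g.
  rewrite -lerBrDr; move: g; apply: Kp_min => g.
    by rewrite -(congr1 (@^~ g) (harmonicB hh Km_h)).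
  rewrite lerBrDr -lerBrDl; move: g; apply: Km_min => g.
    have -> : Pmu0 (fun g => h g - kp g) g = Pmu0 h g - Pmu0 kp g.
      by rewrite /Pmu0 opprD addrACA.
    by rewrite lerB ?h_super ?kp_sub.
  by rewrite lerBrDl.
(* If [Kp] is all of [h], then [Km] vanishes and [h] dominates its translate by [hc]. *)
case: (pselect (forall g, h g <= Kp g)) => [hKp|nhKp].
  have h_le g : h (g * hc)%g <= h g.
    have : Km (g * hc)%g <= 0.
      by move: (Kpm (g * hc)%g) (hKp (g * hc)%g); lra.
    move: (km_Km (g * hc)%g); rewrite {1}/km mulgK; move=> le1 le2.
    by have := le_trans le1 le2; rewrite ge_max subr_le0 => /andP[].
  have [c c0 cE] := extremal_dominates hext (positive_rho hc hp)
    (harmonic_rho hc hh) ltr01 (fun g => ltac:(rewrite mul1r; exact: h_le)).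
  exists c^-1; rewrite ?invr_gt0 // => g.
  by rewrite {2}cE mulKf ?gt_eqF.
have Kp_le g : Kp g <= h g.
  by apply: le_trans (Kpm g); rewrite lerDl; exact: le_trans (km0 g) (km_Km g).
(* Otherwise [h - Kp] is a nonzero harmonic function below both [h] and its translate by [hc]. Being
   proportional to [h], it bounds [h] by a multiple of that translate. *)
have fp : positive (fun g => h g - Kp g).
  split=> [g|e]; first by rewrite subr_ge0.
  by apply: nhKp => g; rewrite -subr_le0 (congr1 (@^~ g) e).
have f_le g : 1 * (h g - Kp g) <= h g.
  rewrite mul1r gerBl; exact: le_trans (kp0 g) (kp_Kp g).
have [t t0 tE] := extremal_dominates hext fp (harmonicB hh Kp_h) ltr01 f_le.
have h_le g : t^-1 * h (g * hc^-1)%g <= h g.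
  have := kp_Kp (g * hc^-1)%g; rewrite /kp mulgVK ge_max => /andP[_ kle].
  rewrite ler_pdivrMl // [leLHS](congr1 (@^~ _) tE) ler_pM2l //.
  by rewrite lerBlDr addrC -lerBlDr.
have [c c0 cE] := extremal_dominates hext (positive_rho hc^-1%g hp)
  (harmonic_rho hc^-1%g hh) (ltac:(by rewrite invr_gt0) : 0 < t^-1) h_le.
by exists c => // g; rewrite [LHS](congr1 (@^~ _) cE) /= /rho mulgK.
Qed.

Lemma bernoulli_ge (x : R) n : 1 <= x -> 1 + n%:R * (x - 1) <= x ^+ n.
Proof.
move=> x1; elim: n => [|n IH]; first by rewrite mul0r addr0.
rewrite exprS; apply: le_trans (_ : x * (1 + n%:R * (x - 1)) <= _); last first.
  by rewrite ler_pM2l // (lt_le_trans ltr01).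
have : 0 <= n%:R * (x - 1) ^+ 2 by rewrite mulr_ge0 ?ler0n ?sqr_ge0.
by rewrite -natr1; lra.
Qed.

Lemma geometric_domination0 (x u v : R) : 1 < x -> 0 <= u ->
  (forall n, x ^+ n * u <= v) -> u = 0.
Proof.
move=> x1 u0 le; apply/eqP; rewrite eq_le u0 andbT leNgt; apply/negP => ugt.
have xu0 : 0 < (x - 1) * u by rewrite mulr_gt0 // subr_gt0.
have := le (Num.bound `|v / ((x - 1) * u)|).
set n := Num.bound _; apply/negP; rewrite -ltNge.
apply: lt_le_trans (_ : (1 + n%:R * (x - 1)) * u <= _); last first.
  by rewrite ler_pM2r // bernoulli_ge // ltW.
apply: lt_le_trans (_ : n%:R * ((x - 1) * u) <= _); last by nra.
by rewrite -ltr_pdivrMr //; apply: le_lt_trans (ler_norm _) _; apply: archi_boundP.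
Qed.

(** With eigenvalue [c], the hypotheses bound [c ^+ n * h (ha^-1 * g)] and [c ^- n * h (hb^-1 * g)]
    by [h g] for all [n]. Thus [c > 1] or [c < 1] would make [h] vanish. *)
Lemma extremal_hc_invariant h : extremal h ->
  (forall k g, h (ha^-1 * g)%g <= h (g * hc ^- k)%g) ->
  (forall k g, h (hb^-1 * g)%g <= h (g * hc ^+ k)%g) ->
  forall g, h (g * hc)%g = h g.
Proof.
move=> hext ha_le hb_le; have [[h_ge0 hn] _ _] := hext.
have [c c0 cE] := extremal_hc_eigen hext (ha_le 1%N) (hb_le 1%N).
have cX n g : h (g * hc ^+ n)%g = c ^+ n * h g.
  elim: n g => [|n IH] g; first by rewrite expg0 mulg1 mul1r.
  by rewrite expgSr mulgA cE IH exprS mulrA.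
have shift_zero k : (forall g, h (k * g)%g = 0) -> False.
  by move=> h0; apply: hn; apply/funext => g; rewrite -(mulVKg k g).
suff c_1 : c = 1 by move=> g; rewrite cE c_1 mul1r.
apply/eqP; rewrite eq_le !leNgt; apply/andP; split; apply/negP => c1.
  apply: (shift_zero ha^-1%g) => g; apply: (geometric_domination0 (v := h g) c1) => // n.
  by rewrite -cX -mulgA; apply: le_trans (ha_le n _) _; rewrite -!mulgA mulgV mulg1.
apply: (shift_zero hb^-1%g) => g.
apply: (geometric_domination0 (x := c^-1) (v := h g)) => // [|n].
  by rewrite invf_gt1.
by rewrite exprVn ler_pdivrMl ?exprn_gt0 // -cX.
Qed.

Lemma hc_invariantE h : (forall g, h (g * hc)%g = h g) ->
  forall x y z w, h (Heis x y z) = h (Heis x y w).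
Proof.
move=> inv x y; suff h0 z : h (Heis x y z) = h (Heis x y 0) by move=> z w; rewrite !h0.
have S k : h (Heis x y (k + 1)) = h (Heis x y k).
  by rewrite -[RHS]inv; congr (h (Heis _ _ _)); rewrite /=; ring.
elim/int_ind: z => [//|n IH|n IH]; first by rewrite -addn1 PoszD S.
by rewrite -S -IH; congr (h (Heis _ _ _)); lia.
Qed.

Lemma int_geometric (u : int -> R) (r : R) : r != 0 ->
  (forall x, u x = r * u (x - 1)) -> forall x, u x = r ^ x * u 0.
Proof.
move=> r0 uS; elim/int_ind => [|n IH|n IH]; first by rewrite mul1r.
  by rewrite uS exprSz -mulrA -IH; congr (_ * u _); lia.
have -> : u (- n.+1%:Z) = r^-1 * u (- n%:Z).
  by rewrite [u (- n%:Z)]uS mulKf //; congr u; lia.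
by rewrite IH mulrA -exprN1 -expfzDr //; congr (r ^ _ * _); lia.
Qed.

Lemma extremal_hc_invariant_character h : extremal h ->
  (forall g, h (g * hc)%g = h g) ->
  exists2 c : R, 0 < c &
    exists2 chi : heis -> R, harmonic_character chi & h = (fun g => c * chi g).
Proof.
move=> hext /hc_invariantE hz; have [hp hh _] := hext.
have hE x y z : h (Heis x y z) = h (Heis (x - 1) y z) + h (Heis x (y - 1) z).
  by rewrite [LHS](congr1 (@^~ _) hh) Pmu0E (hz _ _ _ z).
(* As the third coordinate is immaterial, right translation by [ha^-1] has the effect of the left
   step in [Pmu0]. *)
have ra_le g : 1 * (h \o rho ha^-1%g) g <= h g.
  rewrite mul1r; case: g => x y z; rewrite hE /= (hz _ _ _ z).
  by rewrite addr0 lerDl; exact: hp.1.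
have rb_le g : 1 * (h \o rho hb^-1%g) g <= h g.
  rewrite mul1r; case: g => x y z; rewrite hE /= (hz _ _ _ z).
  by rewrite addr0 lerDr; exact: hp.1.
have [r r0 rE] := extremal_dominates hext (positive_rho _ hp) (harmonic_rho _ hh) ltr01 ra_le.
have [s s0 sE] := extremal_dominates hext (positive_rho _ hp) (harmonic_rho _ hh) ltr01 rb_le.
have rS x y z : h (Heis x y z) = r * h (Heis (x - 1) y z).
  by rewrite [LHS](congr1 (@^~ _) rE) /= (hz _ _ _ z) addr0.
have sS x y z : h (Heis x y z) = s * h (Heis x (y - 1) z).
  by rewrite [LHS](congr1 (@^~ _) sE) /= (hz _ _ _ z) addr0.
have hX x y z : h (Heis x y z) = h (Heis 0 0 0) * (r ^ x * s ^ y).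
  rewrite (int_geometric (u := fun x => h (Heis x y z)) (lt0r_neq0 r0) (fun x => rS x y z)).
  rewrite (int_geometric (u := fun y => h (Heis 0 y z)) (lt0r_neq0 s0) (fun y => sS 0 y z)).
  by rewrite mulrA mulrC (hz 0 0 z 0).
have h1 : 0 < h (Heis 0 0 0).
  rewrite lt_neqAle hp.1 andbT eq_sym; apply/eqP => h1.
  by apply: hp.2; apply/funext => -[x y z]; rewrite hX h1 mul0r.
exists (h (Heis 0 0 0)) => //; exists (fun g => r ^ hx g * s ^ hy g); last first.
  by apply/funext => -[x y z]; exact: hX.
(* The relation between [r] and [s] is harmonicity at the identity, divided by the value of [h]
   there. *)
exists r, s; split=> //; apply: (mulIf (lt0r_neq0 h1)).
rewrite mul1r [RHS]hE mulrDl.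
by congr (_ + _); [rewrite [in LHS](rS 0 0 0)|rewrite [in LHS](sS 0 0 0)]; rewrite mulKf ?gt_eqF.
Qed.

End Character.

Theorem theorem1p1 (R : realType) (h : heis -> R) (hext : extremal h) :
  exists2 c : R, 0 < c &
    [\/ exists2 chi : heis -> R,
          harmonic_character chi & h = (fun g => c * chi g),
        exists g0 : heis, h = (fun g => c * (h0 R \o rho g0) g) |
        exists g0 : heis, h = (fun g => c * (h1 R \o rho g0) g)].
Proof.
have [hp hh _] := hext.
case: (pselect (exists g l, 0 < l /\ forall n, l <= h (ha ^- n * g)%g)) => [[g [l [l0 hl]]]|na].
  by have [c c0 cE] := extremal_along_a hext l0 hl; exists c => //; apply: Or32; exists g^-1%g.
case: (pselect (exists g l, 0 < l /\ forall n, l <= h (hb ^- n * g)%g)) => [[g [l [l0 hl]]]|nb].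
  have hl' n : l <= (h \o sigma) (ha ^- n * sigma g)%g.
    by rewrite /= sigmaM sigmaK sigmaV sigmaX.
  have [c c0 cE] := extremal_along_a (extremal_sigma hext) l0 hl'; exists c => //.
  (* Moving [sigma] past the right translation turns [h0] into [h1] and [sigma g] back into [g]. *)
  apply: Or33; exists g^-1%g; apply/funext => k.
  rewrite -{1}(sigmaK k); have /= -> := congr1 (@^~ (sigma k)) cE.
  by rewrite /rho -sigmaV -sigmaM.
have vanish k : ~ (exists g l, 0 < l /\ forall n, l <= h (k ^- n * g)%g) ->
    forall g e, 0 < e -> exists n, h (k ^- n * g)%g < e.
  move=> nk g e e0; apply: contrapT => /forallNP nlt; apply: nk; exists g, e.
  by split=> // n; rewrite leNgt; apply/negP/nlt.
have ha_le := shift_along_a hp.1 hh (vanish _ na).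
have hb_le := shift_along_b hp.1 hh (vanish _ nb).
have [c c0 chi] := extremal_hc_invariant_character hext (extremal_hc_invariant hext ha_le hb_le).
by exists c => //; apply: Or31.
Qed.
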